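(* Let $(\Omega,\mathcal{F})$ and $(\mathsf{Y},\mathcal{F}_Y)$ be standard Borel spaces, let $\mu$ be a probability measure on $\Omega$, let $K$ be a similarity kernel on $\Omega$, and let $f:\Omega\to\mathsf{Y}$ be measurable. Let $X\sim\mu$, $Y=f(X)$, $\mu_Y:=f_\#\mu$, let $K^{\mathsf{Y},\mu}$ be the posterior-induced output kernel for the pair $(X,Y)=(X,f(X))$, and write $K^{f,\mu}(\omega,\omega'):=K^{\mathsf{Y},\mu}(f(\omega),f(\omega'))$ for its pullback along $f$. Then $$H_K(\mu)\ \ge\ H_{K^{f,\mu}}(\mu)\ =\ H_{K^{\mathsf{Y},\mu}}(\mu_Y).$$
   Context: A similarity kernel on a measurable space $(\Omega,\mathcal{F})$ is a map $K:\Omega\times\Omega\to[0,1]$ that is $\mathcal{F}\otimes\mathcal{F}$-measurable, symmetric, and satisfies $K(\omega,\omega)=1$ for all $\omega$. For a probability measure $\mu$ on $\Omega$, the typicality function is $\tau(\omega):=\int_\Omega K(\omega,\omega')\,d\mu(\omega')$ and the $K$-entropy is $H_K(\mu):=\int_\Omega(-\log\tau(\omega))\,d\mu(\omega)\in[0,\infty]$, with $-\log 0:=+\infty$. Posterior-induced output kernel: let $\{\mu_{X\mid Y=y}\}_{y\in\mathsf{Y}}$ be a regular conditional law of $X$ given $Y$. Then $K^{\mathsf{Y},\mu}:\mathsf{Y}\times\mathsf{Y}\to[0,1]$ is defined, up to $(\mu_Y\otimes\mu_Y)$-a.e. equality (a measurable version is taken), by $K^{\mathsf{Y},\mu}(y,y')=1$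 if $y=y'$, and, if $y\ne y'$, $K^{\mathsf{Y},\mu}(y,y')$ is the essential supremum of $(\omega,\omega')\mapsto K(\omega,\omega')$ with respect to $\mu_{X\mid Y=y}\otimes\mu_{X\mid Y=y'}$. *)

(* Defs.v *)
From HB Require Import structures.
From mathcomp Require Import all_boot all_order all_algebra.
From mathcomp Require Import all_classical all_reals all_analysis.
From mathcomp Require Import measurable_realfun ess_sup_inf.

Set Implicit Arguments.
Unset Strict Implicit.
Unset Printing Implicit Defensive.

Import Order.TTheory GRing.Theory Num.Theory.
Import numFieldNormedType.Exports.

Local Open Scope classical_set_scope.
Local Open Scope ring_scope.
Local Open Scope ereal_scope.

(* [T] is Borel isomorphic to a Polish space. [completePseudoMetricType] only
   provides a complete pseudometric; [hausdorff_space] makes it a metric. *)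
Definition standard_borel (R : realType) (d : measure_display)
    (T : measurableType d) : Prop :=
  exists S : completePseudoMetricType R,
    [/\ hausdorff_space S,
        exists2 D : set S, countable D & dense D &
        exists (phi : T -> g_sigma_algebraType (@open S))
               (psi : g_sigma_algebraType (@open S) -> T),
          [/\ cancel phi psi, cancel psi phi,
              measurable_fun [set: T] phi & measurable_fun [set: _] psi]].

Record similarity_kernel (R : realType) (d : measure_display)
    (T : measurableType d) (K : T * T -> R) : Prop := SimilarityKernel {
  similarity_kernel_measurable : measurable_fun [set: T * T] K ;
  similarity_kernel_itv : forall w w', (0 <= K (w, w') <= 1)%R ;
  similarity_kernel_sym : forall w w', K (w, w') = K (w', w) ;
  similarity_kernel_diag : forall w, K (w, w) = 1%R }.

Definition typicality (R : realType) (d : measure_display)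
    (T : measurableType d) (K : T * T -> R) (mu : probability T R) (w : T)
    : \bar R :=
  \int[mu]_w' (K (w, w'))%:E.

(* [lne] is the extended logarithm, with [lne 0 = -oo]. *)
Definition K_entropy (R : realType) (d : measure_display)
    (T : measurableType d) (K : T * T -> R) (mu : probability T R) : \bar R :=
  \int[mu]_w (- lne (typicality K mu w)).

(* [kappa y] is the law of [X] given [Y = y]. *)
Definition regular_conditional_law (R : realType) (dS d dY : measure_display)
    (S : measurableType dS) (T : measurableType d) (TY : measurableType dY)
    (P : probability S R) (X : {mfun S >-> T}) (Y : {mfun S >-> TY})
    (kappa : TY -> probability T R) : Prop :=
  (forall A : set T, measurable A ->
    measurable_fun [set: TY] (kappa ^~ A)) /\
  (forall (A : set T) (B : set TY), measurable A -> measurable B ->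
    P (X @^-1` A `&` Y @^-1` B) = \int[distribution P Y]_(y in B) kappa y A).

Definition posterior_kernel (R : realType) (d dY : measure_display)
    (T : measurableType d) (TY : measurableType dY)
    (K : T * T -> R) (kappa : TY -> probability T R) (y y' : TY) : \bar R :=
  if pselect (y = y') then 1
  else ess_sup (kappa y \x kappa y') (fun q => (K q)%:E).

(* [KY] is a measurable version of [posterior_kernel K kappa], which is only
   meaningful up to almost everywhere equality, as [kappa] itself is. *)
Record posterior_output_kernel (R : realType) (d dY : measure_display)
    (T : measurableType d) (TY : measurableType dY) (K : T * T -> R)
    (kappa : TY -> probability T R) (muY : probability TY R) (KY : TY * TY -> R)
    : Prop := PosteriorOutputKernel {
  posterior_output_kernel_measurable : measurable_fun [set: TY * TY] KY ;
  posterior_output_kernel_itv : forall y y', (0 <= KY (y, y') <= 1)%R ;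
  posterior_output_kernelE : \forall p \ae muY \x muY,
    (KY p)%:E = posterior_kernel K kappa p.1 p.2 }.

Definition pullback_kernel (R : realType) (T TY : Type) (f : T -> TY)
    (KY : TY * TY -> R) (p : T * T) : R :=
  KY (f p.1, f p.2).

(* Main.v *)
Require Import Defs.
From HB Require Import structures.
From mathcomp Require Import all_boot all_order all_algebra.
From mathcomp Require Import all_classical all_reals all_analysis.
From mathcomp Require Import measurable_realfun ess_sup_inf.

Set Implicit Arguments.
Unset Strict Implicit.
Unset Printing Implicit Defensive.

Import Order.TTheory GRing.Theory Num.Theory.
Import numFieldNormedType.Exports.

Local Open Scope classical_set_scope.
Local Open Scope ring_scope.
Local Open Scope ereal_scope.

(** The entropy is antitone in the kernel: a larger kernel gives a larger
    typicality and hence a smaller [- log]. So the inequality follows once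
    [K (w, w') <= KY (f w, f w')] for [mu]-almost every [w] and then
    [mu]-almost every [w'] ([le_K_entropy]); the equality is a change of
    variables along [f], used once in the typicality and once in the entropy
    ([pullback_kernel_entropy]).

    Let [N] be the measurable set where the domination fails. By
    disintegration, [mu \x mu] is the mixture of the products
    [kappa y \x kappa y'] over [muY \x muY], where [muY] is the law of [f].
    It is enough to follow null sets through this mixture: [N] is null as soon
    as it is [kappa y \x kappa y']-null for almost all [y] and [y']
    ([ae_product_disintegration]).

    For almost every [y], the law [kappa y] is carried by the fibre
    [f^-1 {y}], because countably many measurable sets separate the points of
    a standard Borel space ([ae_concentrated_fibre]). Hence, for
    [kappa y \x kappa y']-almost every [(w, w')], the bound [KY (f w, f w')]
    is the constant [KY (y, y')], which is either [1] or the essential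
    supremum of [K] for that very product measure. In both cases it dominates
    [K] almost everywhere ([posterior_kernel_dominates]). *)

(** * Typicality and entropy *)

Lemma measurable_lne (R : realType) : measurable_fun [set: \bar R] (@lne R).
Proof.
rewrite (_ : @lne R = fun x => if x <= 0 then -oo else
    if +oo <= x then +oo else (ln (fine x))%:E); last first.
  apply/funext => -[r| |]; rewrite ?lee_fin ?leye_eq ?leNye//.
apply: measurable_fun_ifT => //; first exact: measurable_fun_lee.
apply: measurable_fun_ifT => //; first exact: measurable_fun_lee.
apply/measurable_EFinP; apply: measurableT_comp; first exact: measurable_ln.
exact: fine_measurable.
Qed.

Section bounded_kernel.
Context (R : realType) (d : measure_display) (T : measurableType d).
Variables (K : T * T -> R) (mu : probability T R).
Hypothesis mK : measurable_fun setT K.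
Hypothesis K01 : forall x y, (0 <= K (x, y) <= 1)%R.

Let mKe : measurable_fun setT (EFin \o K).
Proof. exact/measurable_EFinP. Qed.

Let Ke_ge0 z : 0 <= (EFin \o K) z.
Proof. by case: z => x y; rewrite lee_fin; case/andP: (K01 x y). Qed.

Lemma measurable_typicality : measurable_fun setT (typicality K mu).
Proof. exact: (measurable_fun_fubini_tonelli_F (m2 := mu) _ mKe Ke_ge0). Qed.

Lemma typicality_ge0 x : 0 <= typicality K mu x.
Proof. by apply: integral_ge0 => y _; exact: Ke_ge0. Qed.

Lemma typicality_le1 x : typicality K mu x <= 1.
Proof.
rewrite -(@probability_setT _ _ _ mu) -[leRHS]mul1e -integral_cst//.
apply: ge0_le_integral => //.
- by move=> y _; exact: Ke_ge0.
- exact/measurable_EFinP/measurable_fun_pair2.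
- by move=> y _; rewrite lee_fin; case/andP: (K01 x y).
Qed.

Lemma K_entropy_integrand_ge0 x : 0 <= - lne (typicality K mu x).
Proof. by rewrite oppe_ge0 lne_le0 typicality_le1. Qed.

Lemma measurable_K_entropy_integrand :
  measurable_fun setT (fun x => - lne (typicality K mu x)).
Proof.
apply: measurableT_comp => //.
exact: measurableT_comp (@measurable_lne R) measurable_typicality.
Qed.

End bounded_kernel.

Lemma le_K_entropy (R : realType) (d : measure_display) (T : measurableType d)
    (K1 K2 : T * T -> R) (mu : probability T R) :
  measurable_fun setT K1 -> (forall x y, (0 <= K1 (x, y) <= 1)%R) ->
  measurable_fun setT K2 -> (forall x y, (0 <= K2 (x, y) <= 1)%R) ->
  {ae mu, forall x, {ae mu, forall y, (K1 (x, y) <= K2 (x, y))%R}} ->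
  K_entropy K2 mu <= K_entropy K1 mu.
Proof.
move=> mK1 K101 mK2 K201 K12; apply: ae_ge0_le_integral => //.
- by move=> x _; exact: K_entropy_integrand_ge0.
- exact: measurable_K_entropy_integrand.
- by move=> x _; exact: K_entropy_integrand_ge0.
- exact: measurable_K_entropy_integrand.
apply: filterS K12 => x K12x _; rewrite leeN2 lee_lne ?in_itv/= ?leey ?andbT;
  [|exact: typicality_ge0..].
apply: ae_ge0_le_integral => //.
- by move=> y _; rewrite lee_fin; case/andP: (K101 x y).
- exact/measurable_EFinP/measurable_fun_pair2.
- by move=> y _; rewrite lee_fin; case/andP: (K201 x y).
- exact/measurable_EFinP/measurable_fun_pair2.
by apply: filterS K12x => y K12xy _; rewrite lee_fin.
Qed.

Lemma measurable_pullback_kernel (R : realType) (d dY : measure_display)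
    (T : measurableType d) (TY : measurableType dY) (f : {mfun T >-> TY})
    (KY : TY * TY -> R) :
  measurable_fun setT KY -> measurable_fun setT (pullback_kernel f KY).
Proof.
move=> mKY; apply: measurableT_comp mKY _.
by apply: measurable_fun_pair; exact: measurableT_comp.
Qed.

Lemma pullback_kernel_entropy (R : realType) (d dY : measure_display)
    (T : measurableType d) (TY : measurableType dY) (mu : probability T R)
    (f : {mfun T >-> TY}) (KY : TY * TY -> R) :
  measurable_fun setT KY -> (forall y y', (0 <= KY (y, y') <= 1)%R) ->
  K_entropy (pullback_kernel f KY) mu = K_entropy KY (distribution mu f).
Proof.
move=> mKY KY01; rewrite /K_entropy ge0_integral_pushforward//.
- apply: eq_integral => w _ /=; congr (- lne _).
  rewrite /typicality ge0_integral_pushforward//.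
  + exact/measurable_EFinP/measurable_fun_pair2.
  + by move=> y _; rewrite lee_fin; case/andP: (KY01 (f w) y).
- exact: measurable_K_entropy_integrand.
- by move=> y _; exact: K_entropy_integrand_ge0.
Qed.

(** * Null sets of product measures *)

Lemma integral_eq0_ae (R : realType) (d : measure_display)
    (T : measurableType d) (m : {measure set T -> \bar R}) (D : set T)
    (g : T -> \bar R) :
  measurable D -> measurable_fun D g -> (forall x, 0 <= g x) ->
  \int[m]_(x in D) g x = 0 <-> {ae m, forall x, D x -> g x = 0}.
Proof.
move=> mD mg g0; have -> : \int[m]_(x in D) g x = \int[m]_(x in D) `|g x|.
  by apply: eq_integral => x _; rewrite gee0_abs.
exact: ae_eq_integral_abs.
Qed.

Section product_null_sets.
Context (R : realType) (d1 d2 : measure_display).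
Context (T1 : measurableType d1) (T2 : measurableType d2).
Variables (m1 : {sigma_finite_measure set T1 -> \bar R}).
Variables (m2 : {sigma_finite_measure set T2 -> \bar R}).

Lemma product_null_xsection (N : set (T1 * T2)) : measurable N ->
  (m1 \x m2) N = 0 <-> {ae m1, forall x, m2 (xsection N x) = 0}.
Proof.
move=> mN; rewrite /product_measure1 integral_eq0_ae//; last first.
  exact: measurable_fun_xsection.
by split; apply: filterS => x // /(_ I).
Qed.

Lemma product_null_ysection (N : set (T1 * T2)) : measurable N ->
  (m1 \x m2) N = 0 <-> {ae m2, forall y, m1 (ysection N y) = 0}.
Proof.
move=> mN; have -> : (m1 \x m2) N = (m1 \x^ m2) N.
  by apply: product_measure_unique => // A B mA mB; exact: product_measure2E.
rewrite /product_measure2 integral_eq0_ae//; last first.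
  exact: measurable_fun_ysection.
by split; apply: filterS => x // /(_ I).
Qed.

(** The null sections are those of a measurable null set that covers the
    failures of [Q]; this is why [Q] may be any predicate. *)
Lemma ae_product_iterated (Q : T1 * T2 -> Prop) :
  {ae m1 \x m2, forall p, Q p} ->
  {ae m1, forall x, {ae m2, forall y, Q (x, y)}}.
Proof.
move=> [N [mN /product_null_xsection -/(_ mN) N0 QN]].
apply: filterS N0 => x Nx0; exists (xsection N x); split => //.
  exact: measurable_xsection.
by move=> y /= nQ; apply/mem_set/QN.
Qed.

Lemma ae_product_fst (Q : T1 -> Prop) :
  {ae m1, forall x, Q x} -> {ae m1 \x m2, forall p, Q p.1}.
Proof.
move=> [N [mN N0 QN]]; exists (N `*` setT); split.
- exact: measurableX.
- have -> : (m1 \x m2) (N `*` setT) = m1 N * m2 setT.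
    exact: product_measure1E.
  by rewrite [X in X * _]N0 mul0e.
- by move=> [x y] /= nQ; split => //; exact: QN.
Qed.

Lemma ae_product_snd (Q : T2 -> Prop) :
  {ae m2, forall y, Q y} -> {ae m1 \x m2, forall p, Q p.2}.
Proof.
move=> [N [mN N0 QN]]; exists (setT `*` N); split.
- exact: measurableX.
- have -> : (m1 \x m2) (setT `*` N) = m1 setT * m2 N.
    exact: product_measure1E.
  by rewrite [X in _ * X]N0 mule0.
- by move=> [x y] /= nQ; split => //; exact: QN.
Qed.

End product_null_sets.

(** * Separating the points of a standard Borel space *)

(** Balls of radius [1 / (j + 1)] around the points of [D] have this property:
    by density some such ball contains [x] and is so small that it stays within
    a ball around [x] that avoids [y]. *)
Lemma separable_hausdorff_separating (R : realType)
    (S : pseudoMetricType R) (D : set S) :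
  hausdorff_space S -> countable D -> dense D ->
  exists2 B : nat -> set S, (forall n, open (B n)) &
    forall x y, x <> y -> exists2 n, B n x & ~ B n y.
Proof.
move=> hS cD dD; have /countable_injP[g ginj] := cD.
(* The injection [g] numbers the points of [D], so [U i j] is either the ball
   around the point with number [i], or empty if no point has this number. *)
pose U i j : set S :=
  \bigcup_(c in [set c | D c /\ g c = i]) (ball c j.+1%:R^-1%R)^°.
(* The default value only affects codes of no pair. *)
pose ij n : nat * nat := odflt (0, 0)%N (unpickle n).
exists (fun n => U (ij n).1 (ij n).2) => [n|x y /eqP xy].
  by apply: bigcup_open => c _; exact: open_interior.
move: hS; rewrite ball_hausdorff => /(_ _ _ xy)[[e ?] /= /eqP disj].
have yNball r : (r <= e%:num)%R -> ~ ball x r y.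
  move=> re xry; suff : set0 y by [].
  by rewrite -disj; split; [exact: le_ball xry|exact: ballxx].
have [j je] : exists j : nat, (j.+1%:R^-1 + j.+1%:R^-1 <= e%:num)%R.
  have [j] : exists j : nat, (0 + j.+1%:R^-1 < e%:num / 2)%R.
    exact: ltr_add_invr.
  by rewrite add0r => /ltW je; exists j; rewrite [leRHS]splitr lerD.
pose r : R := j.+1%:R^-1%R; have r0 : (0 < r)%R by rewrite invr_gt0.
have r2 : (0 < r / 2)%R by rewrite divr_gt0.
(* The centre is taken within half the radius, so that [x] is an interior point
   of the ball. *)
have [c [xc Dc]] : (ball x (r / 2))^° `&` D !=set0.
  apply: dD; last exact: open_interior.
  by exists x; have [] := open_nbhs_ball x (PosNum r2).
have {}xc : ball x (r / 2) c := interior_subset xc.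
have cx : (ball c r)^° x.
  apply: filterS (nbhsx_ballx x _ r2) => z xz.
  by rewrite [r]splitr; apply: ball_triangle xz; exact: ball_sym.
exists (pickle (g c, j)); rewrite /ij pickleK/=; first by exists c.
move=> [c' [Dc' gc'] yc']; apply: (yNball (r + r)%R) => //.
have cc' : c' = c by apply: ginj; rewrite ?inE.
apply: (ball_triangle (y := c)); first exact/ball_sym/(interior_subset cx).
by rewrite -cc'; exact: interior_subset yc'.
Qed.

Lemma standard_borel_separating (R : realType) (d : measure_display)
    (T : measurableType d) : standard_borel R T ->
  exists2 B : nat -> set T, (forall n, measurable (B n)) &
    forall x y, x <> y -> exists2 n, B n x & ~ B n y.
Proof.
move=> [S [hS [D cD dD] [phi [psi [phiK _ mphi _]]]]].
have [B oB sepB] := separable_hausdorff_separating hS cD dD.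
exists (fun n => phi @^-1` B n) => [n|x y xy].
  rewrite -[X in measurable X]setTI; apply: mphi => //.
  by apply: sub_sigma_algebra; exact: oB.
by apply: sepB => /(can_inj phiK).
Qed.

(** * Disintegration along a map *)

Section conditional_law.
Context (R : realType) (d dY : measure_display).
Context (T : measurableType d) (TY : measurableType dY).
Variables (mu : probability T R) (f : {mfun T >-> TY}).
Variable kappa : TY -> probability T R.
Hypothesis mkappa :
  forall A, measurable A -> measurable_fun [set: TY] (kappa ^~ A).
Hypothesis kappaE : forall A B, measurable A -> measurable B ->
  mu (A `&` f @^-1` B) = \int[distribution mu f]_(y in B) kappa y A.

Local Notation muY := (distribution mu f).

Lemma ae_disintegration (A : set T) : measurable A ->
  mu A = 0 <-> {ae muY, forall y, kappa y A = 0}.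
Proof.
move=> mA; have <- : mu (A `&` f @^-1` setT) = mu A.
  by rewrite preimage_setT setIT.
rewrite kappaE// integral_eq0_ae//; last exact: mkappa.
by split; apply: filterS => x // /(_ I).
Qed.

(** The integral of [kappa y (~` f^-1 B)] over [y] in [B] is the mass of the
    empty set [~` f^-1 B `&` f^-1 B]. *)
Lemma ae_fibre_event (B : set TY) : measurable B ->
  {ae muY, forall y, B y -> kappa y (~` (f @^-1` B)) = 0}.
Proof.
move=> mB; have mfB : measurable (f @^-1` B).
  by rewrite -[X in measurable X]setTI; exact: measurable_funPT.
apply/integral_eq0_ae => //.
  by apply: measurable_funTS; apply: mkappa; exact: measurableC.
by rewrite -kappaE ?setICl ?measure0//; exact: measurableC.
Qed.

(** The complement of the fibre over [y] is covered by the countably many null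
    events [f w \notin B n] with [y \in B n], where the [B n] separate points. *)
Lemma ae_concentrated_fibre : standard_borel R TY ->
  {ae muY, forall y, {ae kappa y, forall w, f w = y}}.
Proof.
move=> /standard_borel_separating[B mB sepB].
have /ae_foralln : forall n,
    {ae muY, forall y, B n y -> kappa y (~` (f @^-1` B n)) = 0}.
  by move=> n; exact: ae_fibre_event.
apply: filterS => y By.
have : forall n, {ae kappa y, forall w, B n y -> B n (f w)}.
  move=> n; have [Bny|nBny] := pselect (B n y); last exact: aeW.
  exists (~` (f @^-1` B n)); split; last by move=> w /= /not_implyP[].
    apply: measurableC; rewrite -[X in measurable X]setTI.
    exact: measurable_funPT.
  exact: By.
move=> /ae_foralln; apply: filterS => w Bw; apply: contrapT => fwy.
by have [|n Bny nBnw] := sepB y (f w); [exact/nesym|exact: nBnw (Bw _ Bny)].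
Qed.

(* The family [kappa] is seen as a kernel with a dummy first coordinate, which
   makes the measurability of [measurable_conditional_xsection] an instance of
   the measurability of the sections of a set along a kernel. *)
Let kappa_kernel (p : T * TY) : {measure set T -> \bar R} := kappa p.2.

Let measurable_kappa_kernel U : measurable U ->
  measurable_fun [set: T * TY] (kappa_kernel ^~ U).
Proof. by move=> mU; exact: measurableT_comp (mkappa mU) _. Qed.

HB.instance Definition _ :=
  isKernel.Build _ _ _ _ R kappa_kernel measurable_kappa_kernel.

HB.instance Definition _ := Kernel_isProbability.Build _ _ _ _ R kappa_kernel
  (fun p => probability_setT (kappa p.2)).

Lemma measurable_conditional_xsection (N : set (T * T)) : measurable N ->
  measurable_fun [set: T * TY] (fun p => kappa p.2 (xsection N p.1)).
Proof.
move=> mN; pose N3 := [set q : (T * TY) * T | N (q.1.1, q.2)].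
have mN3 : measurable N3.
  rewrite -[X in measurable X]setTI.
  have : measurable_fun setT (fun q : (T * TY) * T => (q.1.1, q.2)).
    apply: measurable_fun_pair => //.
    by apply: measurableT_comp => //; exact: measurable_fst.
  by move=> /(_ measurableT N mN).
have := @measurable_fun_xsection_finite_kernel _ _ _ _ R kappa_kernel N3.
rewrite inE => /(_ mN3); congr measurable_fun.
Qed.

(** Disintegrating both factors of [mu \x mu] produces the order of
    quantifiers [y], [w], [y'], [w'], while the hypothesis is about [y], [y'],
    [w], [w']. Tonelli exchanges [w] and [y'] for each [y], on the set [M] of
    the [(w, y')] for which the section of [N] at [w] has positive
    [kappa y']-measure. *)
Lemma ae_product_disintegration (N : set (T * T)) : measurable N ->
  {ae muY, forall y, {ae muY, forall y', (kappa y \x kappa y') N = 0}} ->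
  {ae mu, forall w, mu (xsection N w) = 0}.
Proof.
move=> mN kN.
pose W := [set w | mu (xsection N w) != 0].
have mW : measurable W.
  rewrite -[W]setTI; apply: emeasurable_neq => //.
  exact: measurable_fun_xsection.
suff : mu W = 0 by move=> W0; exists W; split => // w /= /eqP.
apply/ae_disintegration => //; apply: filterS kN => y kyN.
pose M := [set p : T * TY | kappa p.2 (xsection N p.1) != 0].
have mM : measurable M.
  rewrite -[M]setTI; apply: emeasurable_neq => //.
  exact: measurable_conditional_xsection.
have : (kappa y \x muY) M = 0.
  apply/product_null_ysection => //; apply: filterS kyN => y'.
  move=> /product_null_xsection -/(_ mN)[Z [mZ Z0 NZ]].
  apply: subset_measure0 Z0 => //; first exact: measurable_ysection.
  by move=> w /=; rewrite ysectionE/= => /eqP nz; exact: NZ.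
move=> /product_null_xsection -/(_ mM)[Z [mZ Z0 MZ]].
apply: subset_measure0 Z0 => //; move=> w /= Ww; apply: MZ => /= Mw.
case/negP: Ww; apply/eqP/ae_disintegration; first exact: measurable_xsection.
exists (xsection M w); split=> //; first exact: measurable_xsection.
by move=> y' /= /eqP nz; rewrite xsectionE.
Qed.

End conditional_law.


(** * Domination by the posterior-induced kernel *)

(** The conditional law of [X] given [f \o X] depends on [X] only through its
    law [mu]; this removes the auxiliary probability space. *)
Lemma regular_conditional_law_distribution (R : realType)
    (d dY dS : measure_display) (Omega : measurableType d)
    (TY : measurableType dY) (S : measurableType dS)
    (mu : probability Omega R) (f : {mfun Omega >-> TY})
    (P : probability S R) (X : {mfun S >-> Omega})
    (kappa : TY -> probability Omega R) (A : set Omega) (B : set TY) :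
  (forall C, measurable C -> distribution P X C = mu C) ->
  regular_conditional_law P X (f \o X : {mfun S >-> TY}) kappa ->
  measurable A -> measurable B ->
  mu (A `&` f @^-1` B) = \int[distribution mu f]_(y in B) kappa y A.
Proof.
move=> X_mu [_ kappaE] mA mB.
have mf C : measurable C -> measurable (f @^-1` C).
  by move=> mC; rewrite -[X in measurable X]setTI; exact: measurable_funPT.
rewrite -X_mu; last exact/measurableI/mf.
transitivity (P (X @^-1` A `&` (f \o X) @^-1` B)); first by [].
rewrite kappaE//; apply: eq_measure_integral => C mC _.
exact: X_mu (mf _ mC).
Qed.

Lemma posterior_kernel_dominates (R : realType) (d dY : measure_display)
    (T : measurableType d) (TY : measurableType dY) (K : T * T -> R)
    (f : T -> TY) (kappa : TY -> probability T R) (y y' : TY) (k : R) :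
  (forall w w', (K (w, w') <= 1)%R) ->
  {ae kappa y, forall w, f w = y} -> {ae kappa y', forall w, f w = y'} ->
  k%:E = posterior_kernel K kappa y y' ->
  {ae kappa y \x kappa y', forall p,
    [/\ f p.1 = y, f p.2 = y' & (K p <= k)%R]}.
Proof.
move=> K1 fy fy' kE.
have Kk : {ae kappa y \x kappa y', forall p, (K p <= k)%R}.
  move: kE; rewrite /posterior_kernel; case: pselect => [? [->]|? kE].
    by apply: aeW => -[w w'].
  apply: filterS (ess_sup_ge (kappa y \x kappa y') (EFin \o K)) => p.
  by rewrite -[X in _ <= X]kE lee_fin.
have := ae_product_fst (kappa y') fy; have := ae_product_snd (kappa y) fy'.
by move: Kk; apply: filterS3 => p.
Qed.

(** The version [KY] and the concentration on fibres are controlled only for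
    almost all [y] and [y'], which is exactly what the disintegration of null
    sets asks for. *)
Lemma le_pullback_kernel (R : realType) (d dY : measure_display)
    (T : measurableType d) (TY : measurableType dY) (mu : probability T R)
    (K : T * T -> R) (f : {mfun T >-> TY}) (kappa : TY -> probability T R)
    (KY : TY * TY -> R) :
  standard_borel R TY -> similarity_kernel K ->
  (forall A, measurable A -> measurable_fun [set: TY] (kappa ^~ A)) ->
  (forall A B, measurable A -> measurable B ->
    mu (A `&` f @^-1` B) = \int[distribution mu f]_(y in B) kappa y A) ->
  posterior_output_kernel K kappa (distribution mu f) KY ->
  {ae mu, forall w, {ae mu, forall w',
    (K (w, w') <= pullback_kernel f KY (w, w'))%R}}.
Proof.
move=> TYB [mK K01 _ _] mkappa kappaE [mKY _ KYE].
pose N := [set p | (K p <= pullback_kernel f KY p)%R = false].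
have mN : measurable N.
  have mle := measurable_fun_ler mK (measurable_pullback_kernel f mKY).
  by rewrite -[N]setTI; exact: (mle measurableT [set false]).
suff : {ae mu, forall w, mu (xsection N w) = 0}.
  apply: filterS => w N0; exists (xsection N w); split => //.
    exact: measurable_xsection.
  by move=> w' /= /negP/negbTE NN; rewrite xsectionE.
apply: (ae_product_disintegration mkappa kappaE) => //.
have conc := ae_concentrated_fibre mkappa kappaE TYB.
apply: filterS2 (conc) (ae_product_iterated KYE) => y fy.
apply: filterS2 conc => y' fy' kE.
have := posterior_kernel_dominates _ fy fy' kE.
case=> [w w'|Z [mZ Z0 ZN]]; first by case/andP: (K01 w w').
apply: subset_measure0 Z0 => // -[w w'] /= Nww'; apply: ZN => /= -[fw fw'].
by move=> le; move: Nww'; rewrite /N/= /pullback_kernel/= fw fw' le.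
Qed.

Theorem theorem4p1 (R : realType) (d dY dS : measure_display)
    (Omega : measurableType d) (TY : measurableType dY) (S : measurableType dS)
    (OmegaB : standard_borel R Omega) (TYB : standard_borel R TY)
    (mu : probability Omega R)
    (K : Omega * Omega -> R) (simK : similarity_kernel K)
    (f : {mfun Omega >-> TY})
    (P : probability S R) (X : {mfun S >-> Omega})
    (X_mu : forall A, measurable A -> distribution P X A = mu A)
    (kappa : TY -> probability Omega R)
    (kappa_law : regular_conditional_law P X (f \o X : {mfun S >-> TY}) kappa)
    (KY : TY * TY -> R)
    (KY_post : posterior_output_kernel K kappa (distribution mu f) KY) :
  K_entropy K mu >= K_entropy (pullback_kernel f KY) mu /\
  K_entropy (pullback_kernel f KY) mu = K_entropy KY (distribution mu f).
Proof.
have [mK K01 _ _] := simK; have [mKY KY01 _] := KY_post.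
split; last exact: pullback_kernel_entropy.
apply: le_K_entropy => //.
- exact: measurable_pullback_kernel.
- by move=> w w'; exact: KY01.
apply: (le_pullback_kernel TYB simK (proj1 kappa_law) _ KY_post) => A B mA mB.
exact: regular_conditional_law_distribution X_mu kappa_law mA mB.
Qed.
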